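(* Let $\alpha>0$, $\alpha\neq1$, $b>0$, $c\in\mathbb R$, $\nu\in\mathbb C$, and consider the Riccati equation $$\Phi'=-\frac{b(\alpha-\alpha^{-1})}{(z-\alpha)(z-\alpha^{-1})}(1+\Phi^2)-\left(\frac{\bar\nu+c}{z-\alpha}-\frac{\nu+c}{z-\alpha^{-1}}+\frac\nu z\right)\Phi .$$ The variable change $\Phi=e^{i\theta}$, $z=e^{i\tau}$ transforms the restriction of this Riccati equation to the torus $\mathbb T^2=\{|\Phi|=|z|=1\}=\mathbb R^2_{\theta,\tau}/2\pi\mathbb Z^2$ to the following differential equation on the torus: $$\frac{d\theta}{d\tau}=\frac{\cos\theta+B+A\sin\tau}{\omega(1-\delta\cos\tau)}+D,$$ where $$\omega=\frac{\alpha+\alpha^{-1}}{2b(\alpha-\alpha^{-1})},\quad D=-\operatorname{Re}\nu,\quad \delta=\frac{2}{\alpha+\alpha^{-1}}\in(0,1),\quad B=\frac{c+\operatorname{Re}\nu}{2b},\quad A=\frac{\operatorname{Im}\nu}{b(\alpha-\alpha^{-1})}.$$ *)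

(* Defs.v *)
(* Stdlib reals with Coquelicot: R, and C = R * R. *)
From Stdlib Require Import Reals.
From Coquelicot Require Import Coquelicot.

Open Scope R_scope.

(* e^{it}. *)
Definition cis (t : R) : C := (cos t, sin t).

Definition riccati_rhs (alpha b c : R) (nu : C) (z Phi : C) : C :=
  (- (RtoC (b * (alpha - / alpha)) / ((z - RtoC alpha) * (z - RtoC (/ alpha))))
     * (1 + Phi * Phi)
   - ((Cconj nu + RtoC c) / (z - RtoC alpha)
      - (nu + RtoC c) / (z - RtoC (/ alpha))
      + nu / z) * Phi)%C.

(* Division in C is total, so the poles of the coefficients have to be
   excluded by hand wherever the equation is asserted. *)
Definition riccati_regular (alpha : R) (z : C) : Prop :=
  z <> RtoC 0 /\ z <> RtoC alpha /\ z <> RtoC (/ alpha).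

Definition unit_circle (z : C) : Prop := Cmod z = 1.

(* Complex derivative of f at z relative to S, i.e. the limit of
   (f w - f z) / (w - z) as w tends to z inside S.  It is the library's
   [is_derive] over the field C with [locally z] replaced by its trace on S. *)
Definition is_derive_in (S : C -> Prop) (f : C -> C) (z l : C) : Prop :=
  @filterdiff C_AbsRing (AbsRing_NormedModule C_AbsRing) C_NormedModule
    f (within S (@locally (AbsRing_UniformSpace C_AbsRing) z)) (fun h : C => scal h l).

(* Phi satisfies the Riccati equation at z in the holomorphic sense. *)
Definition riccati_at (alpha b c : R) (nu : C) (Phi : C -> C) (z : C) : Prop :=
  riccati_regular alpha z /\
  @is_derive C_AbsRing C_NormedModule Phi z (riccati_rhs alpha b c nu z (Phi z)).

(* Phi, seen as a function on (an arc of) the circle |z| = 1, satisfies the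
   Riccati equation at z; for |Phi| = 1 this is the equation restricted to the
   torus. *)
Definition riccati_circle_at (alpha b c : R) (nu : C) (Phi : C -> C) (z : C)
  : Prop :=
  riccati_regular alpha z /\
  is_derive_in unit_circle Phi z (riccati_rhs alpha b c nu z (Phi z)).

(* The velocity at s of the real curve (Phi, z) lies on the complex line
   dPhi = riccati_rhs * dz. *)
Definition riccati_tangent (alpha b c : R) (nu : C) (Phi z : R -> C) (s : R)
  : Prop :=
  riccati_regular alpha (z s) /\
  exists dPhi dz : C,
    @is_derive R_AbsRing C_R_NormedModule Phi s dPhi /\
    @is_derive R_AbsRing C_R_NormedModule z s dz /\
    dPhi = (riccati_rhs alpha b c nu (z s) (Phi s) * dz)%C.

Definition torus_rhs (omega delta A B D : R) (theta tau : R) : R :=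
  (cos theta + B + A * sin tau) / (omega * (1 - delta * cos tau)) + D.

(* Main.v *)
Require Import Defs.
From Stdlib Require Import Reals Lra.
From Coquelicot Require Import Coquelicot.

Open Scope R_scope.

(** Write z = e^{i tau} and Phi = e^{i theta}.  Since dz = i z dtau and
    dPhi = i Phi dtheta, the equation dPhi = F(z, Phi) dz becomes
    dtheta / dtau = z F(z, Phi) / Phi, and everything rests on computing this
    quotient.  Put N = alpha + 1/alpha - 2 cos tau.  From
    1 + z^2 = 2 z cos tau one gets (z - alpha) (1/alpha - z) = z N, so on the
    circle both poles share the real denominator N, which is positive because
    alpha + 1/alpha > 2.  Likewise 1 + Phi^2 = 2 Phi cos theta turns the
    quadratic term into a real multiple of Phi.  In the linear term the
    imaginary parts cancel, thanks to the conjugate of nu in the residue at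
    alpha.  The quotient is therefore real, and it is the right-hand side
    on the torus ([riccati_rhs_on_torus], [riccati_rhs_torus_rhs]).

    The rest is calculus on the circle.  Differentiating a function along the
    arc |z| = 1 is the same as differentiating its pullback by
    t |-> e^{it}, up to the factor i z ([is_derive_in_circle]): that map is
    differentiable, and near any point it has an inverse with Lipschitz control
    ([circle_chart]).  On the side of Phi, a continuous real function theta is
    differentiable as soon as e^{i theta} is ([is_derive_lift]), since
    theta can be recovered locally through arcsin.  For functions that are
    complex differentiable the two notions of derivative agree, because
    the derivative along the arc determines the complex one. *)

(** * The points of the unit circle *)

Lemma cis_mod (t : R) : Cmod (cis t) = 1.
Proof.
unfold Cmod, cis; simpl.
transitivity (sqrt 1); [f_equal | apply sqrt_1].
pose proof (sin2_cos2 t) as H; unfold Rsqr in H; lra.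
Qed.

Lemma cis_neq_0 (t : R) : cis t <> 0.
Proof. apply Cmod_gt_0; rewrite cis_mod; lra. Qed.

Lemma Ci_cis_cancel (t : R) (x y : C) :
  (Ci * cis t * x = Ci * cis t * y)%C -> x = y.
Proof.
intros E; pose proof (cis_neq_0 t) as Hz.
assert (Hi : Ci <> 0) by (apply Cmod_gt_0; rewrite Cmod_Ci; lra).
transitivity (Ci * cis t * x / (Ci * cis t))%C; [|rewrite E]; field; split; assumption.
Qed.

(** Multiplied form of z + 1/z = 2 cos t: it avoids dividing by z. *)
Lemma one_plus_cis_sqr (t : R) : (1 + cis t * cis t = RtoC (2 * cos t) * cis t)%C.
Proof.
pose proof (sin2_cos2 t) as H; unfold Rsqr in H.
apply injective_projections; simpl; lra.
Qed.

Lemma add_inv_gt_2 (a : R) : 0 < a -> a <> 1 -> 2 < a + / a.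
Proof.
intros Ha Ha1.
replace (a + / a) with (2 + (a - 1) ^ 2 * / a) by (field; lra).
assert (0 < (a - 1) ^ 2) by (apply pow2_gt_0; lra).
pose proof (Rinv_0_lt_compat a Ha).
assert (0 < (a - 1) ^ 2 * / a) by (apply Rmult_lt_0_compat; lra).
lra.
Qed.

Lemma pole_gap_pos (a t : R) : 0 < a -> a <> 1 -> 0 < a + / a - 2 * cos t.
Proof.
intros Ha Ha1; pose proof (add_inv_gt_2 a Ha Ha1); pose proof (COS_bound t); lra.
Qed.

(** * The Riccati right-hand side on the torus *)

(** This makes z / (z - a) = (1/a - z) / N and z / (z - 1/a) = (a - z) / N with
    the same real N; when N is nonzero it also shows that neither a nor 1/a
    lies on the circle. *)
Lemma mul_poles (a t : R) : a <> 0 ->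
  ((cis t - RtoC a) * (RtoC (/ a) - cis t) =
   cis t * RtoC (a + / a - 2 * cos t))%C.
Proof.
intros Ha; pose proof (one_plus_cis_sqr t) as H.
rewrite RtoC_minus, RtoC_plus.
assert (E : (RtoC a * RtoC (/ a) = 1)%C) by (rewrite <- RtoC_mult; f_equal; field; exact Ha).
transitivity (cis t * RtoC (/ a) + RtoC a * cis t - RtoC a * RtoC (/ a) - cis t * cis t)%C;
  [ring|].
rewrite E.
transitivity (cis t * RtoC (/ a) + RtoC a * cis t - (1 + cis t * cis t))%C; [ring|].
rewrite H; ring.
Qed.

Lemma cis_minus_pole_neq_0 (a t : R) : 0 < a -> a <> 1 ->
  (cis t - RtoC a)%C <> 0 /\ (cis t - RtoC (/ a))%C <> 0.
Proof.
intros Ha Ha1.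
pose proof (pole_gap_pos a t Ha Ha1) as HN.
assert (Hp : (cis t * RtoC (a + / a - 2 * cos t))%C <> 0).
{ apply Cmult_neq_0; [apply cis_neq_0|].
  intros E; apply RtoC_inj in E; lra. }
rewrite <- mul_poles in Hp by lra.
split; intros E; apply Hp.
- rewrite E; ring.
- replace (RtoC (/ a) - cis t)%C with (- (cis t - RtoC (/ a)))%C by ring.
  rewrite E; ring.
Qed.

Lemma riccati_regular_cis (a t : R) : 0 < a -> a <> 1 -> riccati_regular a (cis t).
Proof.
intros Ha Ha1; destruct (cis_minus_pole_neq_0 a t Ha Ha1) as [H1 H2].
split; [apply cis_neq_0|].
split; intros E; [apply H1|apply H2]; rewrite E; ring.
Qed.

(** Multiplication by z is what makes the coefficients computable from
    [mul_poles]: z / ((z - a) (z - 1/a)) = - 1 / N.  That the factor of Phi on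
    the right is real is what makes the equation tangent to the torus. *)
Lemma riccati_rhs_on_torus (a b c : R) (nu : C) (th t : R) :
  0 < a -> a <> 1 ->
  (riccati_rhs a b c nu (cis t) (cis th) * cis t =
   RtoC ((2 * b * (a - / a) * cos th
          + (c + Re nu) * (a - / a) + 2 * Im nu * sin t)
         / (a + / a - 2 * cos t) - Re nu) * cis th)%C.
Proof.
intros Ha Ha1.
pose proof (pole_gap_pos a t Ha Ha1) as HN.
destruct (cis_minus_pole_neq_0 a t Ha Ha1) as [P1 P2].
pose proof (cis_neq_0 t) as Hz.
assert (Hm := mul_poles a t ltac:(lra)).
set (N := a + / a - 2 * cos t) in *.
assert (HN0 : RtoC N <> 0) by (intros E; apply RtoC_inj in E; lra).
assert (E1 : (cis t / (cis t - RtoC a) = (RtoC (/ a) - cis t) / RtoC N)%C).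
{ replace (cis t) with ((cis t - RtoC a) * (RtoC (/ a) - cis t) / RtoC N)%C at 1
    by (rewrite Hm; field; exact HN0).
  field; split; assumption. }
assert (E2 : (cis t / (cis t - RtoC (/ a)) = (RtoC a - cis t) / RtoC N)%C).
{ replace (cis t) with (- ((cis t - RtoC (/ a)) * (cis t - RtoC a)) / RtoC N)%C at 1.
  - field; split; assumption.
  - transitivity ((cis t - RtoC a) * (RtoC (/ a) - cis t) / RtoC N)%C;
      [field; exact HN0 | rewrite Hm; field; exact HN0]. }
assert (E3 : (cis t / ((cis t - RtoC a) * (cis t - RtoC (/ a))) = - / RtoC N)%C).
{ assert (Hm' : ((cis t - RtoC a) * (cis t - RtoC (/ a)) = - (cis t * RtoC N))%C)
    by (rewrite <- Hm; ring).
  rewrite Hm'; field; split; assumption. }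
assert (E4 : (((Cconj nu + RtoC c) * (RtoC (/ a) - cis t)
              - (nu + RtoC c) * (RtoC a - cis t) + nu * RtoC N)
             = RtoC (Re nu * N - (c + Re nu) * (a - / a) - 2 * Im nu * sin t))%C).
(* The imaginary parts are - (a + 1/a) Im nu from the constant terms,
   2 Im nu cos t from (nu - conj nu) z, and N Im nu; they add up to 0. *)
{ unfold N; destruct nu as [x y]; apply injective_projections; simpl; ring. }
transitivity (- (RtoC (b * (a - / a)) * (cis t / ((cis t - RtoC a) * (cis t - RtoC (/ a)))))
     * (1 + cis th * cis th)
   - ((Cconj nu + RtoC c) * (cis t / (cis t - RtoC a))
      - (nu + RtoC c) * (cis t / (cis t - RtoC (/ a)))
      + nu) * cis th)%C.
{ unfold riccati_rhs; field; repeat split; assumption. }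
rewrite E1, E2, E3, one_plus_cis_sqr.
transitivity ((RtoC (b * (a - / a)) * RtoC (2 * cos th)
  - ((Cconj nu + RtoC c) * (RtoC (/ a) - cis t)
              - (nu + RtoC c) * (RtoC a - cis t) + nu * RtoC N)) / RtoC N * cis th)%C.
{ field; exact HN0. }
rewrite E4, <- RtoC_mult, <- RtoC_minus, <- RtoC_div by lra.
do 2 f_equal; field; lra.
Qed.

(** * Derivatives of curves in the complex plane *)

Lemma is_derive_C_components (g : R -> C) (t : R) (m : C) :
  @is_derive R_AbsRing C_R_NormedModule g t m <->
  is_derive (fun s => Re (g s)) t (Re m) /\ is_derive (fun s => Im (g s)) t (Im m).
Proof.
split.
- intros H; split.
  + apply (filterdiff_comp' (U := R_NormedModule) (V := C_R_NormedModule)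
             (W := R_NormedModule) g Re t _ Re H).
    apply (filterdiff_linear (U := C_R_NormedModule) (V := R_NormedModule)).
    apply is_linear_fst.
  + apply (filterdiff_comp' (U := R_NormedModule) (V := C_R_NormedModule)
             (W := R_NormedModule) g Im t _ Im H).
    apply (filterdiff_linear (U := C_R_NormedModule) (V := R_NormedModule)).
    apply is_linear_snd.
- intros [H1 H2].
  pose proof (filterdiff_comp'_2 (T := R_NormedModule) (U := R_NormedModule)
    (V := R_NormedModule) (W := C_R_NormedModule)
    (fun s => Re (g s)) (fun s => Im (g s)) (fun x y => (x, y)) t _ _
    (fun x y => (x, y)) H1 H2) as H.
  assert (Hid : filterdiff (U := C_R_NormedModule) (V := C_R_NormedModule)
     (fun p : C => (fst p, snd p)) (locally (Re (g t), Im (g t)))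
     (fun p : C => (fst p, snd p))).
  { apply (filterdiff_ext (fun p : C_R_NormedModule => p));
      [intros [x y]; reflexivity|].
    apply (filterdiff_ext_lin _ (fun p : C_R_NormedModule => p));
      [apply filterdiff_id | intros [x y]; reflexivity]. }
  specialize (H Hid).
  unfold is_derive.
  eapply filterdiff_ext; [|eapply filterdiff_ext_lin; [exact H|]].
  + intros s; simpl; destruct (g s); reflexivity.
  + intros s; simpl; destruct m; reflexivity.
Qed.

Lemma is_derive_C_unique (g : R -> C) (t : R) (m m' : C) :
  @is_derive R_AbsRing C_R_NormedModule g t m ->
  @is_derive R_AbsRing C_R_NormedModule g t m' -> m = m'.
Proof.
intros H H'; apply is_derive_C_components in H, H'.
destruct H as [H1 H2], H' as [H1' H2'].
apply injective_projections.
- exact (eq_trans (eq_sym (is_derive_unique _ _ _ H1)) (is_derive_unique _ _ _ H1')).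
- exact (eq_trans (eq_sym (is_derive_unique _ _ _ H2)) (is_derive_unique _ _ _ H2')).
Qed.

Lemma is_derive_cis_comp (theta : R -> R) (t u : R) :
  is_derive theta t u ->
  @is_derive R_AbsRing C_R_NormedModule (fun s => cis (theta s)) t
    (Ci * RtoC u * cis (theta t))%C.
Proof.
intros H; apply is_derive_C_components; split; simpl.
- replace (_ - _) with (u * - sin (theta t)) by ring.
  apply (is_derive_comp cos theta); [apply is_derive_cos | exact H].
- replace (_ + _) with (u * cos (theta t)) by ring.
  apply (is_derive_comp sin theta); [apply is_derive_sin | exact H].
Qed.

Lemma is_derive_cis (t : R) :
  @is_derive R_AbsRing C_R_NormedModule cis t (Ci * cis t)%C.
Proof.
replace (Ci * cis t)%C with (Ci * RtoC 1 * cis t)%C by ring.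
apply (is_derive_cis_comp (fun s => s)); apply (is_derive_id (K := R_AbsRing)).
Qed.

Lemma is_derive_asin_0 : is_derive asin 0 1.
Proof.
apply is_derive_Reals.
assert (H : -1 < 0 < 1) by lra.
replace 1 with (derive_pt asin 0 (derivable_pt_asin 0 H)).
- apply derive_pt_eq_1 with (derivable_pt_asin 0 H); reflexivity.
- rewrite derive_pt_asin.
  replace (1 - 0²) with 1 by (unfold Rsqr; ring).
  rewrite sqrt_1; field.
Qed.

(** Near t the angle theta - theta(t) lies in (-pi/2, pi/2) by continuity, so it
    equals the arcsin of its sine, and that sine is a real-linear combination
    of the components of e^{i theta}.  Without continuity theta could jump by
    multiples of 2 pi. *)
Lemma is_derive_lift (theta : R -> R) (t u : R) :
  continuous theta t ->
  @is_derive R_AbsRing C_R_NormedModule (fun s => cis (theta s)) t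
    (Ci * RtoC u * cis (theta t))%C ->
  is_derive theta t u.
Proof.
intros Hc H; apply is_derive_C_components in H; destruct H as [H1 H2].
set (th0 := theta t) in *.
replace (Re (Ci * RtoC u * cis th0)) with (- (u * sin th0)) in H1 by (simpl; ring).
replace (Im (Ci * RtoC u * cis th0)) with (u * cos th0) in H2 by (simpl; ring).
assert (Hs : is_derive (fun s => sin (theta s - th0)) t u).
{ apply (is_derive_ext (fun s => cos th0 * sin (theta s) - sin th0 * cos (theta s))).
  - intros s; rewrite sin_minus; unfold cis; simpl; ring.
  - replace u with (cos th0 * (u * cos th0) - sin th0 * - (u * sin th0)).
    + apply (is_derive_minus (K := R_AbsRing) (V := R_NormedModule)).
      * apply is_derive_scal; exact H2.
      * apply is_derive_scal; exact H1.
    + pose proof (sin2_cos2 th0) as E; unfold Rsqr in E.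
      transitivity (u * (sin th0 * sin th0 + cos th0 * cos th0)); [ring|].
      rewrite E; ring. }
assert (Ha : is_derive (fun s => asin (sin (theta s - th0))) t u).
{ replace u with (u * 1) by ring.
  apply (is_derive_comp asin (fun s => sin (theta s - th0))); [|exact Hs].
  replace (theta t - th0) with 0 by (unfold th0; ring).
  rewrite sin_0; apply is_derive_asin_0. }
apply (is_derive_ext_loc (fun s => th0 + asin (sin (theta s - th0)))).
- assert (HP : 0 < PI / 2) by apply PI2_RGT_0.
  generalize (Hc _ (locally_ball (theta t) (mkposreal _ HP))).
  unfold filtermap; apply filter_imp; intros s Hs'.
  change (Rabs (theta s - th0) < PI / 2) in Hs'.
  apply Rabs_lt_between in Hs'.
  change (th0 + asin (sin (theta s - th0)) = theta s).
  rewrite asin_sin by lra; ring.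
- replace u with (0 + u) by ring.
  apply (is_derive_plus (K := R_AbsRing) (V := R_NormedModule) (fun _ => th0)); [|exact Ha].
  apply (is_derive_const (K := R_AbsRing) (V := R_NormedModule)).
Qed.

(** * Derivatives along the unit circle *)

(** The explicit estimate is what allows a comparison of derivatives over R
    with derivatives over C, which belong to different normed modules. *)
Lemma is_derive_C_littleo (g : R -> C) (t : R) (m : C) :
  @is_derive R_AbsRing C_R_NormedModule g t m <->
  forall eps : posreal, locally t (fun s =>
    Cmod (g s - g t - RtoC (s - t) * m) <= eps * Rabs (s - t)).
Proof.
assert (E : forall s, Cmod (g s - g t - RtoC (s - t) * m) =
   @norm R_AbsRing C_R_NormedModule (minus (minus (g s) (g t)) (scal (minus s t) m))).
{ intros s; rewrite <- Cmod_norm; f_equal.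
  apply injective_projections; simpl; unfold minus, plus, opp, scal, mult; simpl;
  unfold mult; simpl; ring. }
split.
- intros [_ H] eps.
  generalize (H t (fun P HP => HP) eps); apply filter_imp; intros s Hs.
  rewrite E; exact Hs.
- intros H; split; [apply is_linear_scal_l|].
  intros x Hx; apply (is_filter_lim_locally_unique (V := R_NormedModule)) in Hx; subst x.
  intros eps; generalize (H eps); apply filter_imp; intros s Hs.
  rewrite E in Hs; exact Hs.
Qed.

Lemma is_derive_in_littleo (S : C -> Prop) (f : C -> C) (z l : C) : S z ->
  (is_derive_in S f z l <->
   forall eps : posreal,
     within S (@locally (AbsRing_UniformSpace C_AbsRing) z) (fun w =>
       Cmod (f w - f z - (w - z) * l) <= eps * Cmod (w - z))).
Proof.
intros Hz; split.
- intros [_ H]; apply H.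
  intros P HP; unfold within; revert HP; apply filter_imp; auto.
- intros H; split; [apply (is_linear_scal_l (K := C_AbsRing) (V := C_NormedModule))|].
  intros x Hx.
  assert (HF : ProperFilter' (within S (@locally (AbsRing_UniformSpace C_AbsRing) z))).
  { constructor; [|apply within_filter, (@locally_filter (AbsRing_UniformSpace C_AbsRing) z)].
    intros [d Hd]; apply (Hd z); [apply ball_center | exact Hz]. }
  (* The relative filter still converges to z alone, z being a point of S. *)
  assert (Ex : x = z).
  { apply (is_filter_lim_unique (K := C_AbsRing) (V := AbsRing_NormedModule C_AbsRing)
     (F := within S (@locally (AbsRing_UniformSpace C_AbsRing) z))); [exact Hx|].
    intros P HP; unfold within; revert HP; apply filter_imp; auto. }
  subst x; exact H.
Qed.

Lemma locally_cis (t : R) (P : C -> Prop) :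
  within unit_circle (@locally (AbsRing_UniformSpace C_AbsRing) (cis t)) P ->
  locally t (fun s => P (cis s)).
Proof.
intros [d Hd].
destruct (proj1 (is_derive_C_littleo _ _ _) (is_derive_cis t) (mkposreal 1 Rlt_0_1))
  as [d' Hd'].
assert (He : 0 < Rmin d' (d / 2))
  by (apply Rmin_pos; [apply cond_pos | pose proof (cond_pos d); lra]).
exists (mkposreal _ He); intros s Hs; apply Hd; [|apply cis_mod].
assert (Hs' : Rabs (s - t) < Rmin d' (d / 2)) by exact Hs; clear Hs.
assert (Hd1 : Rabs (s - t) < d') by (eapply Rlt_le_trans; [exact Hs' | apply Rmin_l]).
assert (Hd2 : Rabs (s - t) < d / 2) by (eapply Rlt_le_trans; [exact Hs' | apply Rmin_r]).
specialize (Hd' s Hd1); simpl in Hd'.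
change (Cmod (cis s - cis t) < d).
replace (cis s - cis t)%C with
  ((cis s - cis t - RtoC (s - t) * (Ci * cis t)) + RtoC (s - t) * (Ci * cis t))%C by ring.
eapply Rle_lt_trans; [apply Cmod_triangle|].
rewrite !Cmod_mult, Cmod_R, Cmod_Ci, cis_mod; lra.
Qed.

(** A local inverse of t |-> e^{it}.  Writing w = (p + i q) e^{it}, a point w
    near e^{it} has p > 0, so w = e^{i (t + arcsin q)}; the factor 2 is any
    constant larger than the derivative 1 of arcsin at 0. *)
Lemma circle_chart (t : R) (Q : R -> Prop) :
  locally t Q ->
  within unit_circle (@locally (AbsRing_UniformSpace C_AbsRing) (cis t)) (fun w =>
    exists s, cis s = w /\ Rabs (s - t) <= 2 * Cmod (w - cis t) /\ Q s).
Proof.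
intros [d Hd].
destruct is_derive_asin_0 as [_ Has].
destruct (Has 0 (fun P HP => HP) (mkposreal 1 Rlt_0_1)) as [d' Hd'].
assert (He : 0 < Rmin 1 (Rmin d' (d / 2))).
{ repeat apply Rmin_pos; [lra | apply cond_pos | pose proof (cond_pos d); lra]. }
exists (mkposreal _ He); intros [x y] Hw Hu.
assert (Hw' : Cmod ((x, y) - cis t) < Rmin 1 (Rmin d' (d / 2))) by exact Hw; clear Hw.
set (r := Cmod ((x, y) - cis t)) in *.
assert (H1 : r < 1) by (eapply Rlt_le_trans; [exact Hw' | apply Rmin_l]).
assert (H2 : r < d').
{ eapply Rlt_le_trans; [exact Hw'|].
  eapply Rle_trans; [apply Rmin_r | apply Rmin_l]. }
assert (H3 : r < d / 2).
{ eapply Rlt_le_trans; [exact Hw'|].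
  eapply Rle_trans; apply Rmin_r. }
set (p := x * cos t + y * sin t).
set (q := y * cos t - x * sin t).
pose proof (sin2_cos2 t) as Ht; unfold Rsqr in Ht.
assert (Hxy : x * x + y * y = 1).
{ unfold unit_circle in Hu. pose proof (Cmod2_alt (x, y)) as E; rewrite Hu in E.
  simpl in E; lra. }
assert (Hpq : p * p + q * q = 1).
{ transitivity ((x * x + y * y) * (sin t * sin t + cos t * cos t));
    [unfold p, q; ring | rewrite Hxy, Ht; ring]. }
assert (Hr0 : 0 <= r) by apply Cmod_ge_0.
assert (Hr : r * r = (1 - p) * (1 - p) + q * q).
{ pose proof (Cmod2_alt ((x, y) - cis t)) as E; fold r in E; simpl in E.
  unfold p, q; nra. }
assert (Hq : Rabs q <= r).
{ apply Rabs_le; nra. }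
assert (Hp : 0 < p) by nra.
assert (Hqb : -1 <= q <= 1) by nra.
assert (Hcos : cos (asin q) = p).
{ rewrite cos_asin by exact Hqb.
  replace (1 - q²) with (p * p) by (unfold Rsqr; lra).
  apply sqrt_square; lra. }
assert (Hab : Rabs (asin q) <= 2 * r).
{ specialize (Hd' q).
  assert (Hb : ball 0 d' q).
  { change (Rabs (q - 0) < d'); rewrite Rminus_0_r; lra. }
  specialize (Hd' Hb).
  change (Rabs (asin q - asin 0 - (q - 0) * 1) <= 1 * Rabs (q - 0)) in Hd'.
  rewrite asin_0 in Hd'.
  replace (asin q - 0 - (q - 0) * 1) with (asin q - q) in Hd' by ring.
  rewrite Rminus_0_r in Hd'.
  pose proof (Rabs_triang (asin q - q) q) as HT.
  replace (asin q - q + q) with (asin q) in HT by ring.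
  lra. }
exists (t + asin q); split; [|split].
- unfold cis; rewrite cos_plus, sin_plus, Hcos, sin_asin by exact Hqb.
  f_equal; unfold p, q.
  + transitivity (x * (sin t * sin t + cos t * cos t)); [ring | rewrite Ht; ring].
  + transitivity (y * (sin t * sin t + cos t * cos t)); [ring | rewrite Ht; ring].
- replace (t + asin q - t) with (asin q) by ring; exact Hab.
- apply Hd; change (Rabs (t + asin q - t) < d).
  replace (t + asin q - t) with (asin q) by ring; lra.
Qed.

(** The chain rule for t |-> e^{it}, in both directions.  With w = e^{is} and
    z = e^{it}, the error terms of the two derivatives differ by l times
    (w - z) - (s - t) i z, which is o(s - t), and |w - z| and |s - t| bound each
    other up to a factor 2. *)
Lemma is_derive_in_circle (f : C -> C) (t : R) (l : C) :
  is_derive_in unit_circle f (cis t) l <->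
  @is_derive R_AbsRing C_R_NormedModule (fun s => f (cis s)) t (Ci * cis t * l)%C.
Proof.
rewrite is_derive_in_littleo by apply cis_mod.
rewrite is_derive_C_littleo.
pose proof (proj1 (is_derive_C_littleo _ _ _) (is_derive_cis t)) as Hcis.
pose proof (Cmod_ge_0 l) as Hl.
(* l may vanish, hence the division by |l| + 1. *)
assert (Heta : forall e : posreal, 0 < e / (Cmod l + 1))
  by (intros e; apply Rdiv_lt_0_compat; [apply cond_pos | lra]).
assert (Hle : forall e : posreal, Cmod l * (e / (Cmod l + 1)) <= e).
{ intros e; replace (e : R) with ((Cmod l + 1) * (e / (Cmod l + 1))) at 2 by (field; lra).
  apply Rmult_le_compat_r; [left; apply Heta | lra]. }
split; intros H eps.
- set (e4 := pos_div_2 (pos_div_2 eps)).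
  generalize (filter_and _ _ (locally_cis t _ (H e4))
    (filter_and _ _ (Hcis (mkposreal _ (Heta e4))) (Hcis (mkposreal 1 Rlt_0_1)))).
  apply filter_imp; intros s [A1 [A2 A3]]; simpl in A2, A3.
  set (e := (cis s - cis t - RtoC (s - t) * (Ci * cis t))%C) in *.
  assert (Hz : Cmod (cis s - cis t) <= 2 * Rabs (s - t)).
  { replace (cis s - cis t)%C with (e + RtoC (s - t) * (Ci * cis t))%C by (unfold e; ring).
    eapply Rle_trans; [apply Cmod_triangle|].
    rewrite !Cmod_mult, Cmod_R, Cmod_Ci, cis_mod; lra. }
  replace (_ - _)%C with ((f (cis s) - f (cis t) - (cis s - cis t) * l) + e * l)%C
    by (unfold e; ring).
  eapply Rle_trans; [apply Cmod_triangle|].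
  rewrite Cmod_mult.
  pose proof (Rmult_le_compat_l _ _ _ Hl A2) as B2.
  rewrite <- Rmult_assoc in B2.
  pose proof (Rmult_le_compat_r _ _ _ (Rabs_pos (s - t)) (Hle e4)) as B3.
  pose proof (Rmult_le_compat_l _ _ _ (Rlt_le _ _ (cond_pos e4)) Hz) as B1.
  unfold e4 in *; simpl in *.
  pose proof (Rmult_le_pos _ _ (Rlt_le _ _ (cond_pos eps)) (Rabs_pos (s - t))); lra.
- set (e4 := pos_div_2 (pos_div_2 eps)).
  generalize (circle_chart t _ (filter_and _ _ (H e4) (Hcis (mkposreal _ (Heta e4))))).
  unfold within; apply filter_imp; intros w A Hw; destruct (A Hw) as [s [Es [A1 [A2 A3]]]]; subst w.
  simpl in A3.
  set (e := (cis s - cis t - RtoC (s - t) * (Ci * cis t))%C) in *.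
  replace (_ - _)%C with
    ((f (cis s) - f (cis t) - RtoC (s - t) * (Ci * cis t * l)) + - (e * l))%C
    by (unfold e; ring).
  eapply Rle_trans; [apply Cmod_triangle|].
  rewrite Cmod_opp, Cmod_mult.
  pose proof (Rmult_le_compat_l _ _ _ Hl A3) as B2.
  rewrite <- Rmult_assoc in B2.
  pose proof (Rmult_le_compat_r _ _ _ (Rabs_pos (s - t)) (Hle e4)) as B3.
  pose proof (Rmult_le_compat_l _ _ _ (Rlt_le _ _ (cond_pos e4)) A1) as B1.
  unfold e4 in *; simpl in *; lra.
Qed.

Lemma is_derive_is_derive_in (S : C -> Prop) (f : C -> C) (z l : C) :
  @is_derive C_AbsRing C_NormedModule f z l -> S z -> is_derive_in S f z l.
Proof.
intros [Hlin H] Hz; apply is_derive_in_littleo; [exact Hz|].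
intros eps; unfold within.
generalize (H z (fun P HP => HP) eps); apply filter_imp; intros w Hw _; exact Hw.
Qed.

(** * The change of variables *)

(** Here omega (1 - delta cos t) = N / (2 b (alpha - 1/alpha)), of the sign of
    alpha - 1, hence negative for alpha < 1 but never zero. *)
Lemma riccati_rhs_torus_rhs (alpha b c : R) (nu : C) (omega D delta B A : R) :
  0 < alpha -> alpha <> 1 -> 0 < b ->
  omega = (alpha + / alpha) / (2 * b * (alpha - / alpha)) ->
  D = - Re nu ->
  delta = 2 / (alpha + / alpha) ->
  B = (c + Re nu) / (2 * b) ->
  A = Im nu / (b * (alpha - / alpha)) ->
  forall th t : R,
  omega * (1 - delta * cos t) <> 0 /\
  (riccati_rhs alpha b c nu (cis t) (cis th) * cis t =
   RtoC (torus_rhs omega delta A B D th t) * cis th)%C.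
Proof.
intros Ha Ha1 Hb -> -> -> -> -> th t.
pose proof (pole_gap_pos alpha t Ha Ha1) as HN.
pose proof (add_inv_gt_2 alpha Ha Ha1) as HS.
assert (Hd : alpha - / alpha <> 0).
{ intros E; apply Ha1.
  assert (E2 : alpha * alpha = 1).
  { replace alpha with (/ alpha) at 1 by lra; field; lra. }
  nra. }
assert (Hden : (alpha + / alpha) / (2 * b * (alpha - / alpha))
   * (1 - 2 / (alpha + / alpha) * cos t)
   = (alpha + / alpha - 2 * cos t) / (2 * b * (alpha - / alpha))).
{ set (S := alpha + / alpha) in *; set (d := alpha - / alpha) in *; field.
  repeat split; lra. }
split.
- rewrite Hden; apply Rmult_integral_contrapositive; split; [lra|].
  apply Rinv_neq_0_compat; repeat apply Rmult_integral_contrapositive_currified; lra.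
- rewrite riccati_rhs_on_torus by assumption.
  do 2 f_equal; unfold torus_rhs; rewrite Hden.
  set (S := alpha + / alpha) in *; set (d := alpha - / alpha) in *; field.
  repeat split; lra.
Qed.

Lemma cos_sin_period_Z (x : R) (k : Z) :
  cos (x + 2 * PI * IZR k) = cos x /\ sin (x + 2 * PI * IZR k) = sin x.
Proof.
assert (H : sin (IZR k * PI) = 0) by (apply sin_eq_0_1; exists k; reflexivity).
replace (2 * PI * IZR k) with (2 * (IZR k * PI)) by ring.
rewrite cos_plus, sin_plus, sin_2a, cos_2a_sin, H; split; ring.
Qed.

Theorem proposition22
  (alpha b c : R) (nu : C)
  (Halpha : 0 < alpha) (Halpha1 : alpha <> 1) (Hb : 0 < b)
  (omega D delta B A : R)
  (Homega : omega = (alpha + / alpha) / (2 * b * (alpha - / alpha)))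
  (HD : D = - Re nu)
  (Hdelta : delta = 2 / (alpha + / alpha))
  (HB : B = (c + Re nu) / (2 * b))
  (HA : A = Im nu / (b * (alpha - / alpha))) :
  0 < delta < 1 /\
  (* the right-hand side is defined everywhere, and descends to R^2 / 2 pi Z^2 *)
  (forall tau : R, omega * (1 - delta * cos tau) <> 0) /\
  (forall (theta tau : R) (k l : Z),
     torus_rhs omega delta A B D (theta + 2 * PI * IZR k) (tau + 2 * PI * IZR l)
     = torus_rhs omega delta A B D theta tau) /\
  (* line fields: real directions of the torus on the Riccati complex line *)
  (forall (theta tau : R -> R) (s u v : R),
     is_derive theta s u -> is_derive tau s v ->
     (riccati_tangent alpha b c nu
        (fun t => cis (theta t)) (fun t => cis (tau t)) s
      <-> u = torus_rhs omega delta A B D (theta s) (tau s) * v)) /\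
  (* solutions z |-> Phi z on arcs of the circle, written Phi = e^{i theta} *)
  (forall (J : R -> Prop) (Phi : C -> C) (theta : R -> R),
     open J ->
     (forall tau, J tau -> continuous theta tau) ->
     (forall tau, J tau -> Phi (cis tau) = cis (theta tau)) ->
     forall tau, J tau ->
       (riccati_circle_at alpha b c nu Phi (cis tau)
        <-> is_derive theta tau (torus_rhs omega delta A B D (theta tau) tau))) /\
  (* functions Phi that are moreover complex differentiable *)
  (forall (J : R -> Prop) (Phi : C -> C) (theta : R -> R),
     open J ->
     (forall tau, J tau -> continuous theta tau) ->
     (forall tau, J tau -> Phi (cis tau) = cis (theta tau)) ->
     forall tau, J tau ->
       @ex_derive C_AbsRing C_NormedModule Phi (cis tau) ->
       (riccati_at alpha b c nu Phi (cis tau)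
        <-> is_derive theta tau (torus_rhs omega delta A B D (theta tau) tau))).
Proof.
pose proof (riccati_rhs_torus_rhs alpha b c nu omega D delta B A
  Halpha Halpha1 Hb Homega HD Hdelta HB HA) as Hrhs.
set (T := torus_rhs omega delta A B D) in *.
(* With z fixed, i z F = i T Phi: the derivative demanded of Phi along the arc
   is the one that e^{i theta} has when theta' = T. *)
assert (Hcircle : forall (J : R -> Prop) (Phi : C -> C) (theta : R -> R),
     open J ->
     (forall tau, J tau -> continuous theta tau) ->
     (forall tau, J tau -> Phi (cis tau) = cis (theta tau)) ->
     forall tau, J tau ->
       (riccati_circle_at alpha b c nu Phi (cis tau)
        <-> is_derive theta tau (T (theta tau) tau))).
{ intros J Phi theta HJ Hcont HPhi tau Htau.
  assert (E : (Ci * cis tau * riccati_rhs alpha b c nu (cis tau) (Phi (cis tau))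
             = Ci * RtoC (T (theta tau) tau) * cis (theta tau))%C).
  { rewrite (HPhi tau Htau).
    transitivity (Ci * (riccati_rhs alpha b c nu (cis tau) (cis (theta tau)) * cis tau))%C;
      [ring|].
    rewrite (proj2 (Hrhs (theta tau) tau)); ring. }
  unfold riccati_circle_at; rewrite is_derive_in_circle, E.
  assert (Hloc : locally tau (fun s => Phi (cis s) = cis (theta s)))
    by (generalize (HJ tau Htau); apply filter_imp; exact HPhi).
  split.
  - intros [_ H]; apply is_derive_lift; [exact (Hcont tau Htau)|].
    revert H; apply is_derive_ext_loc; exact Hloc.
  - intros H; split; [apply riccati_regular_cis; assumption|].
    generalize (is_derive_cis_comp _ _ _ H); apply is_derive_ext_loc.
    revert Hloc; apply filter_imp; auto. }
split; [|split; [|split; [|split; [|split]]]].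
- pose proof (add_inv_gt_2 alpha Halpha Halpha1) as HS.
  rewrite Hdelta; split.
  + apply Rdiv_lt_0_compat; lra.
  + apply Rlt_div_l; lra.
- intros tau; exact (proj1 (Hrhs 0 tau)).
- intros theta tau k l; unfold T, torus_rhs.
  destruct (cos_sin_period_Z theta k) as [-> _].
  destruct (cos_sin_period_Z tau l) as [-> ->]; reflexivity.
- intros theta tau s u v Hu Hv.
  pose proof (is_derive_cis_comp _ _ _ Hu) as Du.
  pose proof (is_derive_cis_comp _ _ _ Hv) as Dv.
  assert (E : (riccati_rhs alpha b c nu (cis (tau s)) (cis (theta s))
               * (Ci * RtoC v * cis (tau s))
               = Ci * RtoC (T (theta s) (tau s) * v) * cis (theta s))%C).
  { transitivity (Ci * RtoC v *
      (riccati_rhs alpha b c nu (cis (tau s)) (cis (theta s)) * cis (tau s)))%C; [ring|].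
    rewrite (proj2 (Hrhs (theta s) (tau s))), RtoC_mult; ring. }
  split.
  + intros [_ [dPhi [dz [D1 [D2 Heq]]]]].
    rewrite (is_derive_C_unique _ _ _ _ D1 Du), (is_derive_C_unique _ _ _ _ D2 Dv), E in Heq.
    apply RtoC_inj, (Ci_cis_cancel (theta s)).
    transitivity (Ci * RtoC u * cis (theta s))%C; [ring|rewrite Heq; ring].
  + intros ->; split; [apply riccati_regular_cis; assumption|].
    do 2 eexists; split; [exact Du|]; split; [exact Dv|]; symmetry; exact E.
- exact Hcircle.
- intros J Phi theta HJ Hcont HPhi tau Htau [m Hm].
  rewrite <- (Hcircle J Phi theta HJ Hcont HPhi tau Htau).
  pose proof (is_derive_is_derive_in unit_circle _ _ _ Hm (cis_mod tau)) as Hmc.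
  split; intros [Hreg H]; (split; [exact Hreg|]).
  + apply is_derive_is_derive_in; [exact H | apply cis_mod].
  (* Both the complex derivative m and the Riccati value are derivatives along
     the arc, where derivatives are unique. *)
  + replace (riccati_rhs alpha b c nu (cis tau) (Phi (cis tau))) with m; [exact Hm|].
    apply is_derive_in_circle in Hmc, H.
    exact (Ci_cis_cancel tau _ _ (is_derive_C_unique _ _ _ _ Hmc H)).
Qed.
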